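(* Let $\mathcal W$ be a measure matrix, $R(x)=\prod_{i=1}^d(x-r_i)^{m_i}$ a polynomial of degree $M=\sum_i m_i$, and assume that $G_{\mathcal W}$ and the Christoffel–Sobolev deformed moment matrices $\hat G_L=R(\Lambda)G_{\mathcal W}$, $\hat G_R=G_{\mathcal W}R(\Lambda)^\top$ are $LU$-factorizable. Then the deformed and non-deformed polynomials are related by $$\hat\omega_LP_1(x)=R(x)\hat P_{L1}(x),\quad \hat\Omega_L\hat P_{L2}(x)=P_2(x),\quad \hat\omega_RP_2(x)=R(x)\hat P_{R2}(x),\quad \hat\Omega_R\hat P_{R1}(x)=P_1(x),$$ and the Christoffel–Darboux kernels satisfy, for every $n\ge0$ (quantities with a negative index being zero), $$K^{[n+1]}(x,y)=R(y)\hat K_L^{[n+1]}(x,y)-\big((\hat P_{L2})_{n+1-M}(x),\dots,(\hat P_{L2})_n(x)\big)\,\mathrm{diag}\big((\hat h_L)_{n+1-M}^{-1},\dots,(\hat h_L)_n^{-1}\big)\,\begin{pmatrix}(\hat\omega_L)_{n+1-M,n+1}&&0\\ \vdots&\ddots&\\ (\hat\omega_L)_{n,n+1}&\cdots&(\hat\omega_L)_{n,n+M}\end{pmatrix}\begin{pmatrix}(P_1)_{n+1}(y)\\ \vdots\\ (P_1)_{n+M}(y)\end{pmatrix},$$ $$K^{[n+1]}(y,x)=R(y)\hat K_R^{[n+1]}(y,x)-\big((\hat P_{R1})_{n+1-M}(x),\dots,(\hat P_{R1})_n(x)\big)\,\mathrm{diag}\big((\hat h_R)_{n+1-M}^{-1},\dots,(\hat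 h_R)_n^{-1}\big)\,\begin{pmatrix}(\hat\omega_R)_{n+1-M,n+1}&&0\\ \vdots&\ddots&\\ (\hat\omega_R)_{n,n+1}&\cdots&(\hat\omega_R)_{n,n+M}\end{pmatrix}\begin{pmatrix}(P_2)_{n+1}(y)\\ \vdots\\ (P_2)_{n+M}(y)\end{pmatrix}.$$ Here the $M\times M$ matrices have entries $\hat\omega_{a,b}$, $n+1-M\le a\le n$, $n+1\le b\le n+M$.
   Context: Semi-infinite matrices and vectors are indexed from $0$; $A^{[k]}$ is the leading $k\times k$ truncation. A measure matrix of order $\mathcal N$ is a semi-infinite matrix $\mathcal W=(d\mu_{i,j})$ of (possibly signed) Borel measures on sets $\Omega_{i,j}\subseteq\mathbb R$, zero if $i>\mathcal N$ or $j>\mathcal N$; $(f,h;\mathcal W)=\sum_{n,r}\int_{\Omega_{n,r}}f^{(n)}h^{(r)}d\mu_{n,r}$ (finite on polynomials); $(G_{\mathcal W})_{n,p}=(x^n,x^p;\mathcal W)$. A matrix $G$ is $LU$-factorizable if $\det G^{[k]}\neq0$ for all $k\ge1$; then uniquely $G=S_1^{-1}H(S_2^{-1})^\top$ with $S_1,S_2$ lower unitriangular, $H=\mathrm{diag}(h_0,h_1,\dots)$; the monic polynomial sequences are $P_\alpha(x)=S_\alpha\chi(x)$, $\alpha=1,2$, with $\chi(x)=(1,x,x^2,\dots)^\top$, and the Christoffel–Darboux kernel is $K^{[l]}(x,y)=\sum_{k=0}^{l-1}P_{2,k}(x)h_k^{-1}P_{1,k}(y)$. $\Lambda$ is the shift,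 $\Lambda_{i,j}=\delta_{i+1,j}$, so $\Lambda\chi(x)=x\chi(x)$. The matrices $\hat G_L=R(\Lambda)G_{\mathcal W}$ and $\hat G_R=G_{\mathcal W}R(\Lambda)^\top$ are the moment matrices of the forms $(Rf,h;\mathcal W)$ and $(f,Rh;\mathcal W)$. Their factors, polynomials, norms and kernels are denoted $\hat S_{L\alpha},\hat H_L,\hat P_{L\alpha},\hat h_L,\hat K_L$ and $\hat S_{R\alpha},\hat H_R,\hat P_{R\alpha},\hat h_R,\hat K_R$. Resolvents and adjoint resolvents: $\hat\omega_L:=\hat S_{L1}R(\Lambda)S_1^{-1}$, $\hat\Omega_L:=S_2\hat S_{L2}^{-1}$, $\hat\omega_R:=\hat S_{R2}R(\Lambda)S_2^{-1}$, $\hat\Omega_R:=S_1\hat S_{R1}^{-1}$. *)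

(* Defs.v *)
From HB Require Import structures.
From mathcomp Require Import all_boot all_order all_algebra.
From mathcomp Require Import complex.
From mathcomp Require Import all_classical all_reals all_analysis.

Set Implicit Arguments.
Unset Strict Implicit.
Unset Printing Implicit Defensive.

Import Order.TTheory GRing.Theory Num.Theory.
Import numFieldNormedType.Exports.

Local Open Scope classical_set_scope.
Local Open Scope ring_scope.

Section SignedIntegral.
Context {R : realType}.

(* The Jordan parts of a charge do not depend on the Hahn decomposition chosen
   here, up to their (irrelevant) values on non-measurable sets. *)
Definition hahn_pos (mu : {charge set (measurableTypeR R) -> \bar R}) : set (measurableTypeR R) :=
  projT1 (cid (Hahn_decomposition mu)).

Definition hahn_neg (mu : {charge set (measurableTypeR R) -> \bar R}) : set (measurableTypeR R) :=
  projT1 (cid (projT2 (cid (Hahn_decomposition mu)))).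

Definition hahnP (mu : {charge set (measurableTypeR R) -> \bar R}) :
    hahn_decomposition mu (hahn_pos mu) (hahn_neg mu) :=
  projT2 (cid (projT2 (cid (Hahn_decomposition mu)))).

Definition charge_integrable (mu : {charge set (measurableTypeR R) -> \bar R}) (D : set R) (f : R -> R) :=
  (charge_variation (hahnP mu)).-integrable D (EFin \o f).

Definition charge_integral (mu : {charge set (measurableTypeR R) -> \bar R}) (D : set R) (f : R -> R) : R :=
  Rintegral (jordan_pos (hahnP mu)) D f
  - Rintegral (jordan_neg (hahnP mu)) D f.

End SignedIntegral.

(* A signed Borel measure on Omega i j is encoded as a charge on the Borel sets
   of the line that vanishes outside Omega i j.  Charges are finite, which is
   forced anyway by mm_integrable: x^n and x^r differentiated n and r times are
   non-zero constants. *)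
Record measure_matrix (R : realType) (N : nat) := MeasureMatrix {
  mm_dom : nat -> nat -> set R ;
  mm_mu : nat -> nat -> {charge set (measurableTypeR R) -> \bar R} ;
  mm_dom_measurable : forall n r,
    measurable (mm_dom n r : set (measurableTypeR R)) ;
  mm_carried : forall n r (A : set (measurableTypeR R)),
    measurable A -> A `<=` ~` mm_dom n r -> mm_mu n r A = 0%E ;
  mm_order : forall n r (A : set (measurableTypeR R)),
    (N < n)%N || (N < r)%N -> measurable A -> mm_mu n r A = 0%E ;
  mm_integrable : forall n r (f h : {poly R}),
    charge_integrable (mm_mu n r) (mm_dom n r)
      (fun x => (f^`(n)).[x] * (h^`(r)).[x])
}.

(* The entries of index greater than N vanish, so the double series is finite. *)
Definition sobolev_form (R : realType) (N : nat) (W : measure_matrix R N)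
    (f h : {poly R}) : R :=
  \sum_(n < N.+1) \sum_(r < N.+1)
    charge_integral (mm_mu W n r) (mm_dom W n r)
      (fun x => (f^`(n)).[x] * (h^`(r)).[x]).

Section SemiInfinite.
Context {K : fieldType}.

Definition smx := nat -> nat -> K.

Definition strunc (k : nat) (A : smx) : 'M[K]_k := \matrix_(i, j) A i j.

Definition sid : smx := fun i j => (i == j)%:R.
Definition sdiag (h : nat -> K) : smx := fun i j => h i *+ (i == j).
Definition strans (A : smx) : smx := fun i j => A j i.
Definition sshift : smx := fun i j => (i.+1 == j)%:R.

(* These finitely supported sums are 0 by convention when the support is
   infinite; every product formed below has finitely supported sums, the
   matrices involved being banded above, triangular or diagonal on the
   relevant side. *)
Definition smul (A B : smx) : smx :=
  fun i j => \sum_(k \in [set: nat]) A i k * B k j.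

Definition smulv (V : lmodType K) (A : smx) (v : nat -> V) : nat -> V :=
  fun i => \sum_(k \in [set: nat]) A i k *: v k.

Definition spoly (p : {poly K}) (A : smx) : smx :=
  fun i j => \sum_(k < size p) p`_k * iter k (smul A) sid i j.

Definition lower_unitriangular (S : smx) : Prop :=
  (forall i, S i i = 1) /\ (forall i j, (i < j)%N -> S i j = 0).

(* The inverse inside the group of lower unitriangular matrices; the
   triangularity of the inverse is required since a semi-infinite matrix may
   have several one- or two-sided inverses. *)
Definition sinv (S : smx) : smx :=
  xget sid [set T : smx |
    [/\ lower_unitriangular T, smul S T = sid & smul T S = sid]].

Definition LU_factorizable (G : smx) : Prop :=
  forall k, (0 < k)%N -> \det (strunc k G) != 0.

Definition is_LU (G : smx) (F : smx * smx * (nat -> K)) : Prop :=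
  [/\ lower_unitriangular F.1.1, lower_unitriangular F.1.2
    & G = smul (smul (sinv F.1.1) (sdiag F.2)) (strans (sinv F.1.2))].

(* The unique triple (S_1, S_2, h) when G is LU-factorizable. *)
Definition LU (G : smx) : smx * smx * (nat -> K) :=
  xget (sid, sid, fun=> 1) [set F | is_LU G F].

Definition LU_S1 (G : smx) : smx := (LU G).1.1.
Definition LU_S2 (G : smx) : smx := (LU G).1.2.
Definition LU_h (G : smx) : nat -> K := (LU G).2.

Definition chi : nat -> {poly K} := fun n => 'X^n.

Definition P1 (G : smx) : nat -> {poly K} := smulv (LU_S1 G) chi.
Definition P2 (G : smx) : nat -> {poly K} := smulv (LU_S2 G) chi.

Definition CD_kernel (G : smx) (l : nat) (x y : K) : K :=
  \sum_(k < l) (P2 G k).[x] * (LU_h G k)^-1 * (P1 G k).[y].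

(* If G is the moment matrix of a form (f, h), these are the moment matrices of
   (p f, h) and (f, p h). *)
Definition deformL (p : {poly K}) (G : smx) : smx := smul (spoly p sshift) G.
Definition deformR (p : {poly K}) (G : smx) : smx :=
  smul G (strans (spoly p sshift)).

Definition omegaL (p : {poly K}) (G : smx) : smx :=
  smul (smul (LU_S1 (deformL p G)) (spoly p sshift)) (sinv (LU_S1 G)).
Definition OmegaL (p : {poly K}) (G : smx) : smx :=
  smul (LU_S2 G) (sinv (LU_S2 (deformL p G))).
Definition omegaR (p : {poly K}) (G : smx) : smx :=
  smul (smul (LU_S2 (deformR p G)) (spoly p sshift)) (sinv (LU_S2 G)).
Definition OmegaR (p : {poly K}) (G : smx) : smx :=
  smul (LU_S1 G) (sinv (LU_S1 (deformR p G))).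

(* Sequences extended by 0 to negative indices. *)
Definition zext (V : nmodType) (u : nat -> V) (z : int) : V :=
  if z is Posz n then u n else 0.

(* The i-th index of the window n+1-M, ..., n, possibly negative. *)
Definition window (n M : nat) (i : 'I_M) : int :=
  n.+1%:Z - M%:Z + (i : nat)%:Z.

Definition window_row (Q : nat -> {poly K}) (n M : nat) (x : K) : 'rV[K]_M :=
  \row_(i < M) (zext Q (window n i)).[x].

Definition window_diag (h : nat -> K) (n M : nat) : 'M[K]_M :=
  diag_mx (\row_(i < M) zext (fun a => (h a)^-1) (window n i)).

Definition window_mx (w : smx) (n M : nat) : 'M[K]_M :=
  \matrix_(i < M, j < M) zext (fun a => w a (n.+1 + j)%N) (window n i).

Definition next_col (Q : nat -> {poly K}) (n M : nat) (y : K) : 'cV[K]_M :=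
  \col_(j < M) (Q (n.+1 + j)%N).[y].

End SemiInfinite.

Arguments smx : clear implicits.

(* The moments are real; they are viewed in R[i] because the roots of the
   deforming polynomial may be complex. *)
Definition moment_matrix (R : realType) (N : nat) (W : measure_matrix R N) :
    smx R[i] :=
  fun n p => real_complex R (sobolev_form W 'X^n 'X^p).

(* Main.v *)
Require Import Defs.
From HB Require Import structures.
From mathcomp Require Import all_boot all_order all_algebra.
From mathcomp Require Import complex.
From mathcomp Require Import all_classical all_reals all_analysis.
From mathcomp Require Import zify ring.

Set Implicit Arguments.
Unset Strict Implicit.
Unset Printing Implicit Defensive.

Import Order.TTheory GRing.Theory Num.Theory.

Local Open Scope ring_scope.

(** The statement is linear algebra: it holds for any semi-infinite matrix [G]
    over a field and any polynomial [p] of degree at most [M].  Write [H], [HL]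
    for the diagonal matrices of the pivots of [G] and of [GL = R(Lambda) G],
    and [S1], [S2], [T1], [T2] for their triangular factors, so that
    [S1 G S2^T = H] and [T1 GL T2^T = HL].

    The connection formulas are cancellations of [S1^-1 S1] and [T2^-1 T2],
    together with [R(Lambda) chi = p chi] ([resolvent_connection],
    [adjoint_resolvent_connection]).

    The kernel formulas rest on a duality: the product [T1 R(Lambda) G S2^T] is
    both [omega H] and [HL Omega^T] ([resolvent_adjoint]).  The matrix [Omega]
    is lower unitriangular, so the sum defining the kernel of order [n + 1] of
    [G] can be rewritten with the deformed second polynomials, and the duality
    turns the coefficients into those of [omega].  What appears is the sum of
    row [a <= n] of [omega] against the first polynomials, stopped at column
    [n]; the full row sum is [p] times the deformed first polynomial, which
    produces the deformed kernel.  The difference ([kernel_tail]) consists of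
    the entries of [omega] in rows [a <= n] and columns [k > n]; as [omega] has
    only [M] superdiagonals, they lie in the window of rows [n+1-M, ..., n] and
    columns [n+1, ..., n+M] ([kernel_window]).

    Transposing [G] exchanges left and right deformations and the two
    triangular factors ([is_LU_trans]), so the right-hand formulas are the
    left-hand ones for the transposed matrix.

    Two foundations are needed.  Products of semi-infinite matrices are
    associative only under finiteness conditions; bands provide them
    ([smulA], [smulA_mid], [smulA_trans]).  And the chosen inverses and
    factorizations must have their defining properties: a single elimination
    lemma ([left_elimination]) gives the inverse of a lower unitriangular matrix
    ([sinvP]) and, applied to [G] and its transpose, the factorization
    ([is_LU_exists]), whose pivots are non-zero since their products are the
    leading minors ([is_LU_neq0]). *)

(** * Products of semi-infinite matrices *)

Section SemiInfiniteAlgebra.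
Context {K : fieldType}.
Implicit Types (A B C S T U : smx K) (h g : nat -> K).

Lemma fsum_nat (V : nmodType) (F : nat -> V) n :
  (forall k, (n <= k)%N -> F k = 0) ->
  \sum_(k \in [set: nat]) F k = \sum_(k < n) F k.
Proof.
move=> F0; rewrite fsbig_ord; apply/esym/fsbig_widen => // k [_ /= nk].
by rewrite F0 // leqNgt; apply/negP.
Qed.

(** Row-finiteness is what makes a left factor harmless.  A uniform bound on the
    number of superdiagonals is asked for instead, because it is additive
    under products and also locates the window of the kernel formulas. *)
Definition upper_banded w A := forall i j, (i + w < j)%N -> A i j = 0.

Lemma smulv_bandE (V : lmodType K) w A (v : nat -> V) i n :
  upper_banded w A -> (i + w < n)%N ->
  smulv A v i = \sum_(k < n) A i k *: v k.
Proof.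
by move=> Aw iwn; apply: fsum_nat => k nk; rewrite Aw ?scale0r //; lia.
Qed.

Lemma smul_bandE w A B i j n :
  upper_banded w A -> (i + w < n)%N ->
  smul A B i j = \sum_(k < n) A i k * B k j.
Proof.
by move=> Aw iwn; apply: fsum_nat => k nk; rewrite Aw ?mul0r //; lia.
Qed.

Lemma smul_trans A B : strans (smul A B) = smul (strans B) (strans A).
Proof.
by apply/funext => i; apply/funext => j; apply: eq_fsbigr => k _; rewrite mulrC.
Qed.

Lemma smul_bandTE w A B i j n :
  upper_banded w (strans B) -> (j + w < n)%N ->
  smul A B i j = \sum_(k < n) A i k * B k j.
Proof.
move=> Bw jwn; rewrite -[LHS]/(strans (smul A B) j i) smul_trans.
by rewrite (smul_bandE _ _ Bw jwn); apply: eq_bigr => k _; rewrite mulrC.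
Qed.

Lemma upper_banded_mul a b A B :
  upper_banded a A -> upper_banded b B -> upper_banded (a + b) (smul A B).
Proof.
move=> Aa Bb i j ij; rewrite (smul_bandE _ _ Aa (ltnSn _)) big1 // => k _.
by rewrite Bb ?mulr0 //; have := ltn_ord k; lia.
Qed.

Lemma smulv_smul (V : lmodType K) a b A B (v : nat -> V) :
  upper_banded a A -> upper_banded b B ->
  smulv (smul A B) v = smulv A (smulv B v).
Proof.
move=> Aa Bb; apply/funext => i.
rewrite (smulv_bandE _ (upper_banded_mul Aa Bb) (ltnSn _)).
rewrite (smulv_bandE _ Aa (ltnSn _)).
under [RHS]eq_bigr => k _.
  rewrite (@smulv_bandE _ _ _ _ _ (i + (a + b)).+1 Bb);
    last by have := ltn_ord k; lia.
  rewrite scaler_sumr; over.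
rewrite exchange_big /=; apply: eq_bigr => l _.
rewrite (smul_bandE _ _ Aa (ltnSn _)) scaler_suml.
by apply: eq_bigr => k _; rewrite scalerA.
Qed.

(** A product of matrices is a product of matrix and vector in each column. *)
Lemma smulA a b A B C :
  upper_banded a A -> upper_banded b B ->
  smul (smul A B) C = smul A (smul B C).
Proof.
move=> Aa Bb; apply/funext => i; apply/funext => j.
exact: (congr1 (@^~ i) (@smulv_smul K^o _ _ _ _ (fun k => C k j) Aa Bb)).
Qed.

(** The middle factor is arbitrary here, such as a moment matrix: the outer
    factors alone make all the sums finite. *)
Lemma smulA_mid a c A B C :
  upper_banded a A -> upper_banded c (strans C) ->
  smul (smul A B) C = smul A (smul B C).
Proof.
move=> Aa Cc; apply/funext => i; apply/funext => j.
rewrite (smul_bandTE _ _ Cc (ltnSn _)) (smul_bandE _ _ Aa (ltnSn _)).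
under eq_bigr => l _ do rewrite (smul_bandE _ _ Aa (ltnSn _)) mulr_suml.
rewrite exchange_big /=; apply: eq_bigr => k _.
rewrite (smul_bandTE _ _ Cc (ltnSn _)) mulr_sumr.
by apply: eq_bigr => l _; rewrite mulrA.
Qed.

Lemma smulA_trans b c A B C :
  upper_banded b (strans B) -> upper_banded c (strans C) ->
  smul (smul A B) C = smul A (smul B C).
Proof.
move=> Bb Cc; apply: (congr1 (@strans K) (x := strans _) (y := strans _)).
by rewrite !smul_trans (smulA _ Cc Bb).
Qed.

Lemma upper_banded_sdiag h : upper_banded 0 (sdiag h).
Proof. by move=> i j ij; rewrite /sdiag ltn_eqF //; lia. Qed.

Lemma strans_sdiag h : strans (sdiag h) = sdiag h.
Proof.
apply/funext => i; apply/funext => j; rewrite /strans /sdiag eq_sym.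
by case: eqP => // ->.
Qed.

Lemma sid_sdiag : sid = sdiag (fun=> 1) :> smx K.
Proof. by []. Qed.

Lemma smul_diagl h A i j : smul (sdiag h) A i j = h i * A i j.
Proof.
rewrite (smul_bandE _ _ (upper_banded_sdiag h) (ltnSn _)) addn0 big_ord_recr /=.
rewrite /sdiag eqxx big1 ?add0r // => k _.
by rewrite gtn_eqF ?mul0r.
Qed.

Lemma smul_diagr h A i j : smul A (sdiag h) i j = A i j * h j.
Proof.
rewrite -[LHS]/(strans (smul A (sdiag h)) j i) smul_trans strans_sdiag.
by rewrite smul_diagl mulrC.
Qed.

Lemma smul1 A : smul sid A = A.
Proof. by do 2 apply/funext => ?; rewrite sid_sdiag smul_diagl mul1r. Qed.

Lemma smuls1 A : smul A sid = A.
Proof. by do 2 apply/funext => ?; rewrite sid_sdiag smul_diagr mulr1. Qed.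

Lemma smulv1 (V : lmodType K) (v : nat -> V) : smulv sid v = v.
Proof.
apply/funext => i; rewrite sid_sdiag.
rewrite (smulv_bandE _ (upper_banded_sdiag _) (ltnSn _)) addn0 big_ord_recr /=.
rewrite /sdiag eqxx scale1r big1 ?add0r // => k _.
by rewrite gtn_eqF ?scale0r.
Qed.

Lemma upper_banded_unitri S : lower_unitriangular S -> upper_banded 0 S.
Proof. by move=> [_ S0] i j; rewrite addn0; apply: S0. Qed.

End SemiInfiniteAlgebra.

(** * Triangular elimination and the factorization *)

Section Factorization.
Context {K : fieldType}.
Implicit Types (A G S T U : smx K) (h g : nat -> K).

Lemma strunc_lowerM S A k : lower_unitriangular S ->
  strunc k (smul S A) = strunc k S *m strunc k A.
Proof.
move=> [_ S0]; apply/matrixP => i j; rewrite !mxE.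
under eq_bigr => l _ do rewrite !mxE.
by apply: fsum_nat => l kl; rewrite S0 ?mul0r // (leq_trans (ltn_ord i)).
Qed.

Lemma strunc_trans A k : strunc k (strans A) = (strunc k A)^T.
Proof. by apply/matrixP => i j; rewrite !mxE. Qed.

Lemma det_strunc_unitri S k : lower_unitriangular S -> \det (strunc k S) = 1.
Proof.
move=> [S1 S0]; rewrite det_trig; last first.
  by apply/is_trig_mxP => i j ij; rewrite mxE S0.
by rewrite big1 // => i _; rewrite mxE S1.
Qed.

Lemma LU_factorizable_unitri S : lower_unitriangular S -> LU_factorizable S.
Proof. by move=> Su k _; rewrite det_strunc_unitri // oner_eq0. Qed.

Lemma LU_factorizable_trans G : LU_factorizable G -> LU_factorizable (strans G).
Proof. by move=> detG k k0; rewrite strunc_trans det_tr detG. Qed.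

(** Gaussian elimination, one row at a time: the coefficients that clear the
    first [n] entries of row [n] solve a linear system whose matrix is the
    leading truncation of order [n]. *)
Lemma left_elimination G : LU_factorizable G ->
  exists2 S, lower_unitriangular S &
    forall n q, (q < n)%N -> smul S G n q = 0.
Proof.
move=> detG.
pose c n : 'rV[K]_n := - (\row_j G n j) *m invmx (strunc n G).
(* [insub j] is [None] from the diagonal on, where the row is that of the
   identity. *)
pose S : smx K := fun n j => oapp (c n 0) (j == n)%:R (insub j).
have Sc n (j : 'I_n) : S n j = c n 0 j by rewrite /S valK.
have Snn n : S n n = 1 by rewrite /S insubF ?ltnn //= eqxx.
have S0 i j : (i < j)%N -> S i j = 0.
  by move=> ij; rewrite /S insubF ?gtn_eqF //= ltnNge ltnW.
exists S => // n q qn.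
rewrite (@smul_bandE _ 0 _ _ _ _ n.+1) ?addn0 //; last first.
  by move=> i j; rewrite addn0; apply: S0.
rewrite big_ord_recr /= Snn mul1r.
have Gu : strunc n G \in unitmx.
  by rewrite unitmxE unitfE detG //; case: n qn {c S Sc Snn S0}.
have cG : (c n *m strunc n G) 0 (Ordinal qn) = - G n q.
  by rewrite mulmxKV // !mxE.
apply/eqP; rewrite -[G n q]opprK subr_eq0 -cG mxE; apply/eqP.
by apply: eq_bigr => j _; rewrite Sc [strunc _ _ _ _]mxE.
Qed.

Lemma unitri_mul S T : lower_unitriangular S -> lower_unitriangular T ->
  lower_unitriangular (smul S T).
Proof.
move=> Su Tu; have Sb := upper_banded_unitri Su; split=> [i|i j ij].
  rewrite (@smul_bandE _ 0 _ _ _ _ i.+1) ?addn0 // big_ord_recr /=.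
  rewrite Su.1 Tu.1 mulr1 big1 ?add0r // => k _.
  by rewrite Tu.2 ?mulr0.
by apply: (upper_banded_mul Sb (upper_banded_unitri Tu)); rewrite !addn0.
Qed.

Lemma unitri_left_inverse S : lower_unitriangular S ->
  exists2 T, lower_unitriangular T & smul T S = sid.
Proof.
move=> Su; have [T Tu TS] := left_elimination (LU_factorizable_unitri Su).
exists T => //; have [TS1 TS0] := unitri_mul Tu Su.
apply/funext => i; apply/funext => j; rewrite /sid.
by case: ltngtP => [/TS0|/TS|<-].
Qed.

(** As in any group, a left inverse of a left inverse of [S] is [S]; hence left
    inverses in the class of lower unitriangular matrices are two-sided. *)
Lemma sinvP S : lower_unitriangular S ->
  [/\ lower_unitriangular (sinv S), smul S (sinv S) = sid
    & smul (sinv S) S = sid].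
Proof.
move=> Su; apply: (@xgetPex _ sid [set T | [/\ lower_unitriangular T,
  smul S T = sid & smul T S = sid]]%classic).
have [T Tu TS] := unitri_left_inverse Su.
have [U Uu UT] := unitri_left_inverse Tu.
suff US : U = S by exists T; split=> //; rewrite -US.
rewrite -[U]smuls1 -TS -(smulA S (upper_banded_unitri Uu)
  (upper_banded_unitri Tu)).
by rewrite UT smul1.
Qed.

Lemma sinv_unitri S : lower_unitriangular S -> lower_unitriangular (sinv S).
Proof. by case/sinvP. Qed.

Lemma smul_sinvr S : lower_unitriangular S -> smul S (sinv S) = sid.
Proof. by case/sinvP. Qed.

Lemma smul_sinvl S : lower_unitriangular S -> smul (sinv S) S = sid.
Proof. by case/sinvP. Qed.

Lemma is_LU_unitri1 G S1 S2 h : is_LU G (S1, S2, h) -> lower_unitriangular S1.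
Proof. by case. Qed.

Lemma is_LU_unitri2 G S1 S2 h : is_LU G (S1, S2, h) -> lower_unitriangular S2.
Proof. by case. Qed.

(** Transposition exchanges the two triangular factors; the statements about
    right deformations follow in this way from those about left ones. *)
Lemma is_LU_trans G S1 S2 h : is_LU G (S1, S2, h) ->
  is_LU (strans G) (S2, S1, h).
Proof.
move=> [/= S1u S2u ->]; split=> //=.
rewrite !smul_trans strans_sdiag.
rewrite (smulA_mid _ (c := 0) (upper_banded_unitri (sinv_unitri S2u))) //.
exact/upper_banded_unitri/sinv_unitri.
Qed.

Lemma is_LU_left G S1 S2 h : is_LU G (S1, S2, h) ->
  smul S1 G = smul (sdiag h) (strans (sinv S2)).
Proof.
move=> [/= S1u S2u ->].
have S1b := upper_banded_unitri S1u.
have V1b := upper_banded_unitri (sinv_unitri S1u).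
rewrite (smulA _ V1b (upper_banded_sdiag h)) -(smulA _ S1b V1b).
by rewrite smul_sinvr // smul1.
Qed.

Lemma is_LU_diag G S1 S2 h : is_LU G (S1, S2, h) ->
  smul (smul S1 G) (strans S2) = sdiag h.
Proof.
move=> GE; have [/= _ S2u _] := GE; rewrite (is_LU_left GE).
rewrite (smulA_mid _ (c := 0) (upper_banded_sdiag h)).
  by rewrite -smul_trans smul_sinvr // strans_sdiag smuls1.
exact: upper_banded_unitri.
Qed.

(** Eliminating in [G] and in its transpose gives [S1] and [S2].  The entries
    of [S1 G S2^T] below the diagonal vanish because those of [S1 G] do, and
    those above the diagonal because those of [G S2^T] do. *)
Lemma is_LU_exists G : LU_factorizable G -> exists F, is_LU G F.
Proof.
move=> detG; have [S1 S1u S1G] := left_elimination detG.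
have [S2 S2u S2G] := left_elimination (LU_factorizable_trans detG).
have S1b := upper_banded_unitri S1u; have S2b := upper_banded_unitri S2u.
have V1u := sinv_unitri S1u; have V2u := sinv_unitri S2u.
pose D := smul (smul S1 G) (strans S2).
have D_lower i j : (j < i)%N -> D i j = 0.
  move=> ji; rewrite /D (smul_bandTE (w := 0) _ _ S2b (ltnSn _)).
  by rewrite big1 // => k _; rewrite S1G ?mul0r //; have := ltn_ord k; lia.
have D_upper i j : (i < j)%N -> D i j = 0.
  move=> ij; rewrite /D (smulA_mid _ (c := 0) S1b) //.
  rewrite (smul_bandE _ _ S1b (ltnSn _)) big1 // => k _.
  rewrite -[smul G _]/(strans (strans (smul G (strans S2)))) smul_trans.
  by rewrite [X in _ * X]S2G ?mulr0 //; have := ltn_ord k; lia.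
have DE : D = sdiag (fun n => D n n).
  apply/funext => i; apply/funext => j; rewrite /sdiag.
  by case: ltngtP => [/D_upper|/D_lower|<-].
exists (S1, S2, fun n => D n n); split=> //=; rewrite -DE /D.
have V1b := upper_banded_unitri V1u; have V2b := upper_banded_unitri V2u.
rewrite -(smulA_mid _ (c := 0) V1b) // -(smulA _ V1b S1b) smul_sinvl // smul1.
rewrite (smulA_trans _ (b := 0) (c := 0)) // -smul_trans smul_sinvl //.
by rewrite sid_sdiag strans_sdiag -sid_sdiag smuls1.
Qed.

Lemma LUP G : LU_factorizable G -> is_LU G (LU_S1 G, LU_S2 G, LU_h G).
Proof.
move=> /is_LU_exists LUG; rewrite /LU_S1 /LU_S2 /LU_h -!surjective_pairing.
exact: (@xgetPex _ _ [set F | is_LU G F]%classic).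
Qed.

(** The product of the first [k] pivots is the leading minor of order [k],
    because truncation commutes with triangular products. *)
Lemma is_LU_neq0 G S1 S2 h : LU_factorizable G -> is_LU G (S1, S2, h) ->
  forall k, h k != 0.
Proof.
move=> detG GE k; have [/= S1u S2u _] := GE.
have : \det (strunc k.+1 (sdiag h)) != 0.
  rewrite -(is_LU_diag GE) -[smul _ _]/(strans (strans (smul _ _))).
  rewrite smul_trans strunc_trans det_tr strunc_lowerM // det_mulmx.
  rewrite (strunc_trans (smul S1 G)) det_tr strunc_lowerM // det_mulmx.
  by rewrite (det_strunc_unitri _ S1u) (det_strunc_unitri _ S2u) !mul1r detG.
rewrite det_trig; last first.
  by apply/is_trig_mxP => i j ij; rewrite mxE /sdiag ltn_eqF.
rewrite big_ord_recr mulf_eq0 negb_or /= => /andP[_].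
by rewrite mxE /sdiag eqxx.
Qed.

End Factorization.

(** * Resolvents and kernels of a deformed matrix *)

Section Christoffel.
Context {K : fieldType}.
Implicit Types (G S T : smx K) (h g : nat -> K) (p : {poly K}).

(** Multiplication by [p] in the monomial basis: row [i] lists the
    coefficients of [p * 'X^i]. *)
Lemma spoly_shiftE p i j : spoly p sshift i j = (p * 'X^i)`_j.
Proof.
have shiftE (A : smx K) a b : smul sshift A a b = A a.+1 b.
  rewrite (@smul_bandE _ 1 _ _ _ _ a.+2) ?addn1 //; last first.
    by move=> k l kl; rewrite /sshift ltn_eqF //; lia.
  rewrite big_ord_recr /= /sshift eqxx mul1r big1 ?add0r // => k _.
  by rewrite gtn_eqF ?mul0r.
have iterE k a b : iter k (smul sshift) sid a b = (a + k == b)%N%:R :> K.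
  elim: k a => [|k IHk] a /=; first by rewrite addn0.
  by rewrite shiftE IHk addSnnS.
rewrite -[in RHS](coefK p) poly_def mulr_suml coef_sum.
apply: eq_bigr => k _; rewrite iterE -scalerAl -exprD coefZ coefXn.
by rewrite addnC eq_sym.
Qed.

Lemma upper_banded_spoly p M : (size p <= M.+1)%N ->
  upper_banded M (spoly p sshift).
Proof.
move=> pM i j ij; rewrite spoly_shiftE coefMXn; case: ltnP => // ji.
by rewrite nth_default // (leq_trans pM) //; lia.
Qed.

Lemma smulv_spoly_chi p i : smulv (spoly p sshift) chi i = p * 'X^i.
Proof.
have pM : (size p <= (size p).+1)%N by [].
rewrite (smulv_bandE _ (upper_banded_spoly pM) (ltnSn _)).
under eq_bigr => k _ do rewrite spoly_shiftE.
rewrite -(poly_def _ (fun k => (p * 'X^i)`_k)).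
apply/polyP => k; rewrite coef_poly; case: ltnP => // ik.
rewrite nth_default // (leq_trans (size_polyMleq _ _)) //.
by rewrite size_polyXn addnS addnC ltnW.
Qed.

(** A sum over the window [n+1-M, ..., n] is a sum over all indices up to [n]
    of a summand that vanishes before the window; if [M > n + 1], the indices
    of the window that come first are negative. *)
Lemma sum_window (F : nat -> K) n m :
  (forall a, (a + m <= n)%N -> F a = 0) ->
  \sum_(i < m) zext F (window n i) = \sum_(a < n.+1) F a.
Proof.
move=> F0.
pose w k := zext F (n.+1%:Z - m%:Z + k%:Z).
have wE k b : (b + m = n.+1 + k)%N -> w k = F b.
  by rewrite /w => e; have -> : n.+1%:Z - m%:Z + k%:Z = b%:Z by lia.
have wN k : (n.+1 + k < m)%N -> w k = 0.
  rewrite /w => lt.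
  by have -> : n.+1%:Z - m%:Z + k%:Z = Negz (m - n.+1 - k).-1 by lia.
rewrite -[LHS]/(\sum_(i < m) w i); case: (leqP m n.+1) => mn.
  rewrite -[in RHS](subnK mn) big_split_ord /=.
  rewrite [X in _ = X + _]big1 ?add0r => [|a _].
    by apply: eq_bigr => i _; apply: wE; lia.
  by apply: F0; have := ltn_ord a; lia.
rewrite -[X in \sum_(i < X) w i](subnK (ltnW mn)) big_split_ord /=.
rewrite big1 ?add0r => [|i _]; last by apply: wN; have := ltn_ord i; lia.
by apply: eq_bigr => a _; apply: wE; lia.
Qed.

Lemma deformR_trans p G : strans (deformR p G) = deformL p (strans G).
Proof. by rewrite /deformR smul_trans. Qed.

(* The factorizations are arbitrary here, not the chosen ones, so that the
   results apply as well to the transposed factors of a transposed matrix. *)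
Variables (p : {poly K}) (M : nat).
Hypothesis size_p : (size p <= M.+1)%N.

Variables (G S1 S2 T1 T2 : smx K) (h g : nat -> K).
Hypothesis GE : is_LU G (S1, S2, h).
Hypothesis GLE : is_LU (deformL p G) (T1, T2, g).

Let omega := smul (smul T1 (spoly p sshift)) (sinv S1).
Let Omega := smul S2 (sinv T2).

Let S1u := is_LU_unitri1 GE.
Let S2u := is_LU_unitri2 GE.
Let T1u := is_LU_unitri1 GLE.
Let T2u := is_LU_unitri2 GLE.
Let S1b := upper_banded_unitri S1u.
Let T1b := upper_banded_unitri T1u.
Let V1b := upper_banded_unitri (sinv_unitri S1u).
Let Rb := upper_banded_spoly size_p.
Let T1Rb := upper_banded_mul T1b Rb.

Lemma upper_banded_resolvent : upper_banded M omega.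
Proof. by have := upper_banded_mul T1Rb V1b; rewrite add0n addn0. Qed.

(** Cancelling [S1^-1 S1] leaves [T1] acting on [R(Lambda) chi = p chi]. *)
Lemma resolvent_connection k :
  smulv omega (smulv S1 chi) k = p * smulv T1 chi k.
Proof.
rewrite (smulv_smul _ T1Rb V1b) -(smulv_smul chi V1b S1b) smul_sinvl //.
rewrite smulv1 (smulv_smul _ T1b Rb) !(smulv_bandE _ T1b (ltnSn _)).
rewrite mulr_sumr; apply: eq_bigr => i _.
by rewrite smulv_spoly_chi scalerAr.
Qed.

Lemma adjoint_resolvent_unitri : lower_unitriangular Omega.
Proof. exact: unitri_mul S2u (sinv_unitri T2u). Qed.

Lemma adjoint_resolvent_connection k :
  smulv Omega (smulv T2 chi) k = smulv S2 chi k.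
Proof.
have T2b := upper_banded_unitri T2u.
have V2b := upper_banded_unitri (sinv_unitri T2u).
rewrite (smulv_smul _ (upper_banded_unitri S2u) V2b).
by rewrite -(smulv_smul chi V2b T2b) smul_sinvl // smulv1.
Qed.

(** The duality of the two resolvents.  Both sides are the entries of
    [T1 R(Lambda) G S2^T]: on the one hand [S1 G S2^T] is the diagonal matrix of
    [h]; on the other hand [T1 R(Lambda) G] is [T1] times the deformed matrix,
    that is, the diagonal matrix of [g] times [T2^-T]. *)
Lemma resolvent_adjoint a k : omega a k * h k = g a * Omega k a.
Proof.
have S2b := upper_banded_unitri S2u.
have omega_b := upper_banded_resolvent.
have omegaG : smul omega (smul S1 G) = smul (sdiag g) (strans (sinv T2)).
  rewrite -(is_LU_left GLE) -(smulA _ omega_b S1b) (smulA _ T1Rb V1b).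
  by rewrite smul_sinvl // smuls1 (smulA _ T1b Rb).
rewrite -smul_diagr -(is_LU_diag GE) -(smulA_mid _ (c := 0) omega_b) // omegaG.
rewrite (smulA_mid _ (c := 0) (upper_banded_sdiag g)) // -smul_trans.
by rewrite smul_diagl.
Qed.

Hypothesis h_neq0 : forall k, h k != 0.
Hypothesis g_neq0 : forall k, g k != 0.

Let cd (Q P : nat -> {poly K}) (e : nat -> K) l x y : K :=
  \sum_(k < l) (Q k).[x] * (e k)^-1 * (P k).[y].

(** Expanding [P2] over the deformed [P2] through [Omega], and turning [Omega]
    into [omega], leaves the sums of [omega] against [P1] cut after index [n];
    the uncut sums are the values of [p] times the deformed [P1]. *)
Lemma kernel_tail n x y :
  cd (smulv S2 chi) (smulv S1 chi) h n.+1 x y =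
  p.[y] * cd (smulv T2 chi) (smulv T1 chi) g n.+1 x y
  - \sum_(j < M) (\sum_(a < n.+1) (smulv T2 chi a).[x] * (g a)^-1
       * omega a (n.+1 + j)%N) * (smulv S1 chi (n.+1 + j)%N).[y].
Proof.
set Q1 := smulv S1 chi; set Q2 := smulv T2 chi.
have Ob := upper_banded_unitri adjoint_resolvent_unitri.
(* The band of [omega] reaches from column [n] at most to column [n + M]. *)
have full a : (a < n.+1)%N ->
    p.[y] * (smulv T1 chi a).[y] =
    \sum_(k < n.+1) omega a k * (Q1 k).[y]
    + \sum_(j < M) omega a (n.+1 + j)%N * (Q1 (n.+1 + j)%N).[y].
  move=> an; rewrite -hornerM -resolvent_connection.
  rewrite (@smulv_bandE _ _ _ _ _ _ (n.+1 + M) upper_banded_resolvent);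
    last by lia.
  rewrite horner_sum big_split_ord /=.
  by congr (_ + _); apply: eq_bigr => k _; rewrite hornerZ.
have cut : cd (smulv S2 chi) Q1 h n.+1 x y =
    \sum_(a < n.+1) (Q2 a).[x] * (g a)^-1
       * \sum_(k < n.+1) omega a k * (Q1 k).[y].
  under [RHS]eq_bigr => a _ do rewrite mulr_sumr.
  rewrite exchange_big /=; apply: eq_bigr => k _.
  rewrite -adjoint_resolvent_connection (@smulv_bandE _ _ _ _ _ _ n.+1 Ob);
    last by have := ltn_ord k; lia.
  rewrite horner_sum !mulr_suml; apply: eq_bigr => a _.
  have -> : omega a k = g a * Omega k a / h k.
    by rewrite -resolvent_adjoint mulfK.
  by rewrite hornerZ; field; rewrite h_neq0 g_neq0.
apply/eqP; rewrite cut /cd mulr_sumr eq_sym subr_eq; apply/eqP.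
under [X in _ = _ + X]eq_bigr => j _ do rewrite mulr_suml.
rewrite [X in _ = _ + X]exchange_big -big_split /=; apply: eq_bigr => a _.
under [X in _ = _ + X]eq_bigr => j _ do rewrite -mulrA.
rewrite -mulr_sumr -mulrDr -full //.
by rewrite mulrCA.
Qed.

(** Entry [(i, j)] sits at column [n + 1 + j] and row [n + 1 - M + i], hence
    above the [M]-th superdiagonal of [omega] as soon as [i < j]. *)
Lemma window_mx_trig n : is_trig_mx (window_mx omega n M).
Proof.
apply/is_trig_mxP => i j ij; rewrite mxE.
have : (window n i < (n.+1 + i)%N%:Z - M%:Z + 1)%R by rewrite /window; lia.
case: (window n i) => // a; rewrite /= => aM.
by apply: upper_banded_resolvent; lia.
Qed.

(** In row [a], the sums left over in [kernel_tail] stop at column [a + M]; so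
    only the rows [a > n - M] have entries beyond column [n], and the double
    sum is the product of the window matrices. *)
Lemma kernel_window n x y :
  cd (smulv S2 chi) (smulv S1 chi) h n.+1 x y =
  p.[y] * cd (smulv T2 chi) (smulv T1 chi) g n.+1 x y
  - (window_row (smulv T2 chi) n M x *m window_diag g n M
       *m window_mx omega n M *m next_col (smulv S1 chi) n M y) 0 0.
Proof.
rewrite kernel_tail; congr (_ - _); rewrite mxE; apply: eq_bigr => j _.
rewrite [next_col _ _ _ _ _ _]mxE; congr (_ * _); rewrite mxE.
pose F a := (smulv T2 chi a).[x] * (g a)^-1 * omega a (n.+1 + j)%N.
rewrite -(@sum_window F _ M) => [|a aM]; last first.
  by rewrite /F upper_banded_resolvent ?mulr0 //; lia.
apply: eq_bigr => i _; rewrite mul_mx_diag !mxE.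
by case: (window n i) => [a|a] /=; rewrite ?horner0 ?mulr0.
Qed.

End Christoffel.

(** * The Christoffel formulas for Sobolev moment matrices *)

Lemma size_prod_XsubC_exp (K : fieldType) (d : nat) (r : 'I_d -> K)
    (m : 'I_d -> nat) :
  size (\prod_(i < d) ('X - (r i)%:P) ^+ m i) = (\sum_(i < d) m i)%N.+1.
Proof.
pose mon (q : {poly K}) k := (q \is monic) && (size q == k.+1).
suff /andP[_ /eqP //] :
  mon (\prod_(i < d) ('X - (r i)%:P) ^+ m i) (\sum_(i < d) m i)%N.
apply: (big_ind2 mon) => [|q k q' k' /andP[qm /eqP qk] /andP[qm' /eqP qk']|i _].
- by rewrite /mon monic1 size_poly1.
- rewrite /mon monicMl // qm' size_monicM ?monic_neq0 // qk qk'.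
  by rewrite addSn addnS /= eqxx.
- by rewrite /mon monic_exp ?monicXsubC // size_exp_XsubC eqxx.
Qed.

Theorem proposition17 (R : realType) (N : nat) (W : measure_matrix R N)
    (d : nat) (r : 'I_d -> R[i]) (m : 'I_d -> nat) :
  let p : {poly R[i]} := \prod_(i < d) ('X - (r i)%:P) ^+ m i in
  let M := (\sum_(i < d) m i)%N in
  let G := moment_matrix W in
  let GL := deformL p G in
  let GR := deformR p G in
  LU_factorizable G -> LU_factorizable GL -> LU_factorizable GR ->
  [/\ [/\ forall k, smulv (omegaL p G) (P1 G) k = p * P1 GL k,
          forall k, smulv (OmegaL p G) (P2 GL) k = P2 G k,
          forall k, smulv (omegaR p G) (P2 G) k = p * P2 GR k
        & forall k, smulv (OmegaR p G) (P1 GR) k = P1 G k],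
      forall n : nat,
        is_trig_mx (window_mx (omegaL p G) n M) /\
        forall x y : R[i],
          CD_kernel G n.+1 x y =
            p.[y] * CD_kernel GL n.+1 x y
            - (window_row (P2 GL) n M x *m window_diag (LU_h GL) n M
                 *m window_mx (omegaL p G) n M
                 *m next_col (P1 G) n M y) 0 0
    & forall n : nat,
        is_trig_mx (window_mx (omegaR p G) n M) /\
        forall x y : R[i],
          CD_kernel G n.+1 y x =
            p.[y] * CD_kernel GR n.+1 y x
            - (window_row (P1 GR) n M x *m window_diag (LU_h GR) n M
                 *m window_mx (omegaR p G) n M
                 *m next_col (P2 G) n M y) 0 0].
Proof.
move=> p M G GL GR detG detGL detGR.
have pM : (size p <= M.+1)%N by rewrite size_prod_XsubC_exp.
have GE := LUP detG; have GLE := LUP detGL; have GRE := LUP detGR.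
have hG := is_LU_neq0 detG GE.
have hGL := is_LU_neq0 detGL GLE; have hGR := is_LU_neq0 detGR GRE.
have GtE := is_LU_trans GE.
have GRtE := is_LU_trans GRE; rewrite deformR_trans in GRtE.
have CD_trans (A : smx R[i]) l x y : CD_kernel A l y x =
    \sum_(k < l) (P1 A k).[x] * (LU_h A k)^-1 * (P2 A k).[y].
  by apply: eq_bigr => k _; rewrite mulrC [_ * _^-1]mulrC mulrA.
split.
- split=> k.
  + exact (resolvent_connection pM GE GLE k).
  + exact (adjoint_resolvent_connection GE GLE k).
  + exact (resolvent_connection pM GtE GRtE k).
  + exact (adjoint_resolvent_connection GtE GRtE k).
- move=> n; split=> [|x y]; first exact (window_mx_trig pM GE GLE n).
  exact (kernel_window pM GE GLE hG hGL n x y).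
- move=> n; split=> [|x y]; first exact (window_mx_trig pM GtE GRtE n).
  rewrite !CD_trans.
  exact (kernel_window pM GtE GRtE hG hGR n x y).
Qed.
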